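(* Let $\mathcal X\in\mathbb R^{m\times n\times p}$ and let $\mathcal V\in\mathbb R^{n\times r\times p}$ satisfy $\mathcal V^\top*\mathcal V=\mathcal I_r$. Let $J=(j_1,\dots,j_r)$ be the random index set returned by T-ARP applied to $\mathcal V$, and suppose that the frequency alignment and rank growth assumption (stated in the context) holds for $\mathcal V$ with constants $\eta_1,\dots,\eta_r\ge 1$. Then $$\mathbb E\left\|\mathcal X-\mathcal X(:,J,:)*\mathcal V(J,:,:)^{-T}*\mathcal V^\top\right\|_F^2\le \Gamma_\eta\left\|\mathcal X-\mathcal X*\mathcal V*\mathcal V^\top\right\|_F^2,\qquad \Gamma_\eta=\prod_{k=1}^r\left(1+\frac{\eta_k}{r-k+1}\right).$$ In the perfectly aligned case (perfect alignment at every step $k=1,\dots,r$, so that $\eta_k=1$ for all $k$), $\Gamma_\eta=r+1$.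
   Context: T-product conventions. For a tensor $\mathcal A$ with $p$ frontal slices $A^{(k)}$, its Fourier slices are $\widehat A^{(\ell)}=\sum_{k=1}^p e^{-2\pi i(\ell-1)(k-1)/p}A^{(k)}$, $\ell=1,\dots,p$. The t-product $\mathcal A*\mathcal B$ is the tensor with Fourier slices $\widehat A^{(\ell)}\widehat B^{(\ell)}$ (equivalently, matrix multiplication with circular convolution of tubes). For real $\mathcal A$, $\mathcal A^\top$ is the real tensor with Fourier slices $(\widehat A^{(\ell)})^H$. The identity tensor $\mathcal I_n$ has first frontal slice $I_n$ and all others zero. Inverses and Moore–Penrose pseudoinverses under the t-product are taken slicewise in the Fourier domain; $\mathcal A^{-T}:=(\mathcal A^\top)^{-1}$. $\|\cdot\|_F$ is the Frobenius norm. For an index tuple $J=(j_1,\dots,j_k)$, $E_J=[e_{j_1},\dots,e_{j_k}]\in\mathbb R^{n\times k}$. T-ARP. Input: $\mathcal V\in\mathbb R^{n\times r\times p}$ with $\mathcal V^\top*\mathcal V=\mathcal I_r$. Set $J_0=()$, $\mathcal W^{(0)}=\mathcal V$. For $k=1,\dots,r$: conditionally on $J_{k-1}$, sample $j_k\in\{1,\dots,n\}$ with probability of $j$ equal to $\|\mathcal W^{(k-1)}(j,:,:)\|_F^2/\|\mathcal W^{(k-1)}\|_F^2$; set $J_k=(J_{k-1},j_k)$, $\mathcal Z_k=\mathcal W^{(k-1)}(j_k,:,:)$ and $\mathcal W^{(k)}=\mathcal W^{(k-1)}*(\mathcal I_r-\mathcal Z_k^\dagger*\mathcal Z_k)$.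 Output: $J=J_r$. Write $\widehat W^{(k,\ell)}$ for the $\ell$-th Fourier slice of $\mathcal W^{(k)}$. Sampling quantities. For a history $J_{k-1}$ of positive probability, put $a_{j,k}^{(\ell)}=\|\widehat W^{(k-1,\ell)}(j,:)\|_2^2$, $$q_{j,k}=\frac{\sum_{\nu=1}^p a_{j,k}^{(\nu)}}{\sum_{i=1}^n\sum_{\nu=1}^p a_{i,k}^{(\nu)}},\qquad p_{j,k}^{(\ell)}=\frac{a_{j,k}^{(\ell)}}{\sum_{i=1}^n a_{i,k}^{(\ell)}}.$$ Frequency alignment and rank growth assumption (for $\mathcal V$, with constants $\eta_k\ge1$, $k=1,\dots,r$): (i) for every $k=1,\dots,r$, every history $J_{k-1}$ of positive probability, every frequency $\ell$, and every index $j$ with $a_{j,k}^{(\ell)}>0$, one has $q_{j,k}\le\eta_k p_{j,k}^{(\ell)}$; (ii) for every $k=0,1,\dots,r$, every history $J_k$ of positive probability and every frequency $\ell$, $\operatorname{rank}(E_{J_k}^H\widehat V^{(\ell)})=k$. (Condition (ii) at $k=r$ makes $\mathcal V(J,:,:)$ invertible.) The distributions are perfectly aligned at step $k$ when $q_{j,k}=p_{j,k}^{(\ell)}$ for all $j,\ell$ (for every history of positive probability); this corresponds to $\eta_k=1$. *)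

(* Defs.v *)
From HB Require Import structures.
From mathcomp Require Import all_boot all_order all_algebra.
From mathcomp Require Import boolp classical_sets reals trigo.
From mathcomp.real_closed Require Import complex.
From mathcomp Require Import ring lra zify.

Set Implicit Arguments.
Unset Strict Implicit.
Unset Printing Implicit Defensive.

Import Order.TTheory GRing.Theory Num.Theory.
Local Open Scope ring_scope.
Local Open Scope sesquilinear_scope.

(* A real m x n x p tensor is the family of its p frontal slices.  Slices and
   frequencies are numbered from 0, so that (l-1)(k-1) reads l * k below. *)
Notation tensor R m n p := {ffun 'I_p -> 'M[R]_(m, n)}.

Definition expi {R : realType} (t : R) : R[i] := Complex (cos t) (sin t).

Definition dft_angle (R : realType) (p l k : nat) : R :=
  2 * pi * (l * k)%:R / p%:R.

Definition fourier {R : realType} {m n p} (A : tensor R m n p) (l : 'I_p) :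
    'M[R[i]]_(m, n) :=
  \sum_(k < p) expi (- dft_angle R p l k) *: map_mx (real_complex R) (A k).

(* The real tensor with prescribed Fourier slices.  The inverse transform of
   the Fourier slices of a real tensor is real, hence the real part loses
   nothing on the families [F] it is applied to: see [fourierK]. *)
Definition of_fourier {R : realType} {m n p} (F : 'I_p -> 'M[R[i]]_(m, n)) :
    tensor R m n p :=
  [ffun k : 'I_p => map_mx (@complex.Re R)
     (p%:R^-1 *: \sum_(l < p) expi (dft_angle R p l k) *: F l)].

Definition is_mpinv {R : realType} {m n} (A : 'M[R[i]]_(m, n))
    (X : 'M[R[i]]_(n, m)) : Prop :=
  [/\ A *m X *m A = A, X *m A *m X = X,
      (A *m X) ^t* = A *m X & (X *m A) ^t* = X *m A].

Definition mpinv {R : realType} {m n} (A : 'M[R[i]]_(m, n)) :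
    'M[R[i]]_(n, m) :=
  xget 0 [set X | is_mpinv A X]%classic.

Definition tmul {R : realType} {m n q p} (A : tensor R m n p)
    (B : tensor R n q p) : tensor R m q p :=
  of_fourier (fun l => fourier A l *m fourier B l).

Definition ttr {R : realType} {m n p} (A : tensor R m n p) : tensor R n m p :=
  of_fourier (fun l => (fourier A l) ^t*).

Definition tinv {R : realType} {n p} (A : tensor R n n p) : tensor R n n p :=
  of_fourier (fun l => invmx (fourier A l)).

Definition tpinv {R : realType} {m n p} (A : tensor R m n p) :
    tensor R n m p :=
  of_fourier (fun l => mpinv (fourier A l)).

Definition tid {R : realType} n p : tensor R n n p :=
  [ffun k : 'I_p => if k == 0%N :> nat then 1%:M else 0].

Definition tfro2 {R : realType} {m n p} (A : tensor R m n p) : R :=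
  \sum_k \sum_i \sum_j A k i j ^+ 2.

Definition trow {R : realType} {m n p} (j : 'I_m) (A : tensor R m n p) :
    tensor R 1 n p :=
  [ffun k => row j (A k)].

Definition trows {R : realType} {m n p r} (J : r.-tuple 'I_m)
    (A : tensor R m n p) : tensor R r n p :=
  [ffun k => rowsub (tnth J) (A k)].

Definition tcols {R : realType} {m n p r} (J : r.-tuple 'I_n)
    (A : tensor R m n p) : tensor R m r p :=
  [ffun k => colsub (tnth J) (A k)].

(* Selection probability of the slice j when the current residual is W. *)
Definition sel_prob {R : realType} {n r p} (W : tensor R n r p) (j : 'I_n) : R :=
  tfro2 (trow j W) / tfro2 W.

Definition tarp_step {R : realType} {n r p} (W : tensor R n r p) (j : 'I_n) :
    tensor R n r p :=
  tmul W (tid r p - tmul (tpinv (trow j W)) (trow j W)).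

(* The residual W^(k) after the history s = (j_1, ..., j_k). *)
Definition tarp_residual {R : realType} {n r p} (V : tensor R n r p)
    (s : seq 'I_n) : tensor R n r p :=
  foldl tarp_step V s.

(* The probability that T-ARP started at V first selects s, in this order. *)
Fixpoint tarp_prob {R : realType} {n r p} (V : tensor R n r p)
    (s : seq 'I_n) : R :=
  if s is j :: s' then sel_prob V j * tarp_prob (tarp_step V j) s' else 1.

Definition tarp_expect {R : realType} {n r p} (V : tensor R n r p)
    (f : r.-tuple 'I_n -> R) : R :=
  \sum_(J : r.-tuple 'I_n) tarp_prob V J * f J.

(* a_{j,k}^(l), q_{j,k} and p_{j,k}^(l) for the residual W = W^(k-1). *)
Definition freq_energy {R : realType} {n r p} (W : tensor R n r p)
    (j : 'I_n) (l : 'I_p) : R :=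
  \sum_c (complex.Re (fourier W l j c) ^+ 2 +
          complex.Im (fourier W l j c) ^+ 2).

Definition joint_prob {R : realType} {n r p} (W : tensor R n r p)
    (j : 'I_n) : R :=
  (\sum_l freq_energy W j l) / (\sum_i \sum_l freq_energy W i l).

Definition freq_prob {R : realType} {n r p} (W : tensor R n r p)
    (j : 'I_n) (l : 'I_p) : R :=
  freq_energy W j l / \sum_i freq_energy W i l.

Definition sel_mx {R : realType} {n k} (s : k.-tuple 'I_n) : 'M[R[i]]_(n, k) :=
  \matrix_(i, c) (i == tnth s c)%:R.

(* With k : 'I_r the step is k + 1, so its history has length k and eta k is
   eta_{k+1}. *)
Definition frequency_alignment {R : realType} {n r p} (V : tensor R n r p)
    (eta : 'I_r -> R) : Prop :=
  forall (k : 'I_r) (s : k.-tuple 'I_n), 0 < tarp_prob V s ->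
  forall (l : 'I_p) (j : 'I_n),
    0 < freq_energy (tarp_residual V s) j l ->
    joint_prob (tarp_residual V s) j <=
      eta k * freq_prob (tarp_residual V s) j l.

Definition rank_growth {R : realType} {n r p} (V : tensor R n r p) : Prop :=
  forall (k : nat) (s : k.-tuple 'I_n), (k <= r)%N -> 0 < tarp_prob V s ->
  forall l : 'I_p, \rank ((sel_mx s) ^t* *m fourier V l) = k.

Definition aligned_rank_growth {R : realType} {n r p} (V : tensor R n r p)
    (eta : 'I_r -> R) : Prop :=
  frequency_alignment V eta /\ rank_growth V.

Definition perfectly_aligned {R : realType} {n r p} (V : tensor R n r p) :
    Prop :=
  forall (k : 'I_r) (s : k.-tuple 'I_n), 0 < tarp_prob V s ->
  forall (l : 'I_p) (j : 'I_n),
    joint_prob (tarp_residual V s) j = freq_prob (tarp_residual V s) j l.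

Definition Gamma {R : realType} {r} (eta : 'I_r -> R) : R :=
  \prod_(k < r) (1 + eta k / (r - k)%:R).

(* Soundness of the real tensor operations: their Fourier slices are the
   prescribed ones. *)

Definition conj_sym {R : realType} {m n p} (F : 'I_p -> 'M[R[i]]_(m, n)) :=
  forall l l' : 'I_p, (p %| l + l')%N -> F l' = map_mx Num.conj (F l).

Lemma conjE {R : realType} (z : R[i]) :
  Num.conj z = Complex (complex.Re z) (- complex.Im z).
Proof. by case: z. Qed.

Lemma expi0 {R : realType} : expi (0 : R) = 1.
Proof. by rewrite /expi cos0 sin0. Qed.

Lemma expiD {R : realType} (a b : R) : expi (a + b) = expi a * expi b.
Proof.
by apply/eqP; rewrite eq_complex /= cosD sinD eqxx addrC eqxx.
Qed.

Lemma expiN {R : realType} (a : R) : expi (- a) = Num.conj (expi a).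
Proof. by rewrite conjE /expi /= cosN sinN. Qed.

Lemma expi_neq0 {R : realType} (a : R) : expi a != 0.
Proof.
apply/eqP => a0; have := expiD a (- a).
by rewrite a0 mul0r subrr expi0 => /eqP; rewrite oner_eq0.
Qed.

Lemma expi_nat {R : realType} (a : R) d : expi (a * d%:R) = expi a ^+ d.
Proof.
elim: d => [|d IH]; first by rewrite mulr0 expr0 expi0.
by rewrite -addn1 natrD mulrDr mulr1 expiD IH addn1 exprSr.
Qed.

Lemma expi_eq1 {R : realType} (a : R) : 0 < a < 2 * pi -> expi a != 1.
Proof.
move=> /andP[a0 a2]; apply/eqP => -[ca _].
have sa : 0 < sin (a / 2).
  by apply: sin_gt0_pi; rewrite divr_gt0 //= ltr_pdivrMr // mulrC.
move: ca; have -> : a = (a / 2) *+ 2 by lra.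
rewrite cos_mulr2n cos2sin2 => h.
by have := exprn_gt0 2 sa; lra.
Qed.

Lemma expi_angle {R : realType} p l k : (0 < p)%N ->
  expi (dft_angle R p l k) = expi (2 * pi / p%:R) ^+ (l * k).
Proof.
by move=> p0; rewrite -expi_nat /dft_angle mulrAC.
Qed.

Lemma expi_primitive {R : realType} p : (0 < p)%N ->
  p.-primitive_root (expi (2 * pi / p%:R : R)).
Proof.
move=> p0; apply/andP; split=> //; apply/forallP => i.
have pR : (0 : R) < p%:R by rewrite ltr0n.
rewrite unity_rootE -expi_nat; apply/eqP; case: (ltngtP i.+1 p).
- move=> ip; apply/negbTE/expi_eq1; apply/andP; split.
    by rewrite mulr_gt0 ?ltr0n // divr_gt0 // mulr_gt0 // pi_gt0.
  rewrite mulrAC ltr_pdivrMr // ltr_pM2l ?ltr_nat //.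
  by rewrite mulr_gt0 // pi_gt0.
- by rewrite ltnNge ltn_ord.
- move=> ->; rewrite divfK; last by rewrite gt_eqF.
  have -> : 2 * pi = pi *+ 2 :> R by lra.
  by rewrite /expi cos2pi sin2pi eqxx.
Qed.

Lemma dft_orth {R : realType} p (l l' : 'I_p) :
  \sum_(k < p) expi (dft_angle R p l' k) * expi (- dft_angle R p l k)
  = (p * (l == l'))%:R.
Proof.
have p0 : (0 < p)%N by apply: leq_ltn_trans (ltn_ord l).
have prim := @expi_primitive R p p0.
pose w : R[i] := expi (2 * pi / p%:R).
pose z := w ^+ l' * w ^- l.
have w0 : w != 0 := expi_neq0 _.
have E k : expi (dft_angle R p l' k) * expi (- dft_angle R p l k) = z ^+ k.
  have -> : expi (- dft_angle R p l k) = (expi (dft_angle R p l k))^-1.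
    apply: (mulIf (expi_neq0 (dft_angle R p l k))).
    by rewrite mulVf ?expi_neq0 // -expiD addNr expi0.
  by rewrite !expi_angle // exprMn exprVn -!exprM.
under eq_bigr do rewrite E.
have [ll'|ll'] := eqVneq l l'.
  under eq_bigr do rewrite /z ll' divff ?expf_neq0 // expr1n.
  by rewrite sumr_const card_ord muln1.
have z1 : z != 1.
  apply: contra ll' => /eqP h.
  have /esym/eqP := divr1_eq h.
  by rewrite (eq_prim_root_expr prim) !modn_small.
have := subrX1 z p; rewrite exprMn exprVn -!exprM ![(_ * p)%N]mulnC !exprM.
rewrite (prim_expr_order prim) !expr1n invr1 mulr1 subrr muln0 => /esym/eqP.
by rewrite mulf_eq0 subr_eq0 (negbTE z1) => /eqP.
Qed.

Lemma expi_dvd {R : realType} p (l l' : 'I_p) k : (p %| l + l')%N ->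
  expi (dft_angle R p l' k) = Num.conj (expi (dft_angle R p l k)).
Proof.
have p0 : (0 < p)%N by apply: leq_ltn_trans (ltn_ord l).
have prim := @expi_primitive R p p0.
move=> pl; rewrite -expiN; apply: (mulIf (expi_neq0 (dft_angle R p l k))).
rewrite -[RHS]expiD addNr expi0 !expi_angle // -exprD -mulnDl addnC.
by case/dvdnP: pl => q ->; rewrite -mulnA mulnC -mulnA exprM
  (prim_expr_order prim) expr1n.
Qed.

Lemma fourierK {R : realType} {m n p} (F : 'I_p -> 'M[R[i]]_(m, n)) l :
  conj_sym F -> fourier (of_fourier F) l = F l.
Proof.
have p0 : (0 < p)%N by apply: leq_ltn_trans (ltn_ord l).
move=> Fs; pose neg (j : 'I_p) := Ordinal (ltn_pmod (p - j) p0).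
have negP (j : 'I_p) : (p %| j + neg j)%N.
  by rewrite /dvdn /= modnDmr subnKC ?modnn // ltnW.
have negK : involutive neg.
  move=> j; apply: val_inj => /=; have := ltn_ord j.
  case: (posnP j) => [->|j0 jp]; first by rewrite subn0 modnn subn0 modnn.
  by rewrite [((p - j) %% p)%N]modn_small ?modn_small; lia.
pose G k : 'M[R[i]]_(m, n) :=
  p%:R^-1 *: \sum_(l < p) expi (dft_angle R p l k) *: F l.
have Greal k : map_mx Num.conj (G k) = G k.
  rewrite /G map_mxZ map_mx_sum; congr (_ *: _).
    by rewrite fmorphV rmorph_nat.
  rewrite [RHS](reindex_inj (inv_inj negK)); apply: eq_bigr => j _ /=.
  by rewrite map_mxZ -(Fs _ _ (negP j)) (expi_dvd _ (negP j)).
have GE (k : 'I_p) : map_mx (real_complex R) (of_fourier F k) = G k.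
  apply/matrixP => i j; rewrite ffunE !mxE.
  have := congr1 (fun M : 'M[R[i]]_(m, n) => M i j) (Greal k).
  rewrite /G !mxE conjE => /eqP; rewrite eq_complex /= => /andP[_].
  by move=> /eqP h; apply/eqP; rewrite eq_complex /= eqxx; apply/eqP; lra.
rewrite /fourier; under eq_bigr do rewrite GE /G scalerA mulrC -scalerA scaler_sumr.
rewrite -scaler_sumr exchange_big /=.
under eq_bigr => j _.
  under eq_bigr do rewrite scalerA mulrC.
  rewrite -scaler_suml dft_orth; over.
rewrite (bigD1 l) //= eqxx muln1 big1 ?addr0 => [|j jl].
  by rewrite scalerA mulVf ?scale1r // pnatr_eq0 -lt0n.
by rewrite eq_sym (negbTE jl) muln0 scale0r.
Qed.

Lemma fourier_sym {R : realType} {m n p} (A : tensor R m n p) :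
  conj_sym (fourier A).
Proof.
move=> l l' ll'; rewrite /fourier map_mx_sum; apply: eq_bigr => k _.
rewrite map_mxZ !expiN (expi_dvd _ ll'); congr (_ *: _).
by apply/matrixP => i j; rewrite !mxE; apply/eqP; rewrite eq_complex /= oppr0 !eqxx.
Qed.

Lemma fourier_tmul {R : realType} {m n q p} (A : tensor R m n p)
    (B : tensor R n q p) l :
  fourier (tmul A B) l = fourier A l *m fourier B l.
Proof.
apply: (fourierK (F := fun l => fourier A l *m fourier B l)) => i j ij.
by rewrite map_mxM -!(fourier_sym _ ij).
Qed.

Lemma fourier_ttr {R : realType} {m n p} (A : tensor R m n p) l :
  fourier (ttr A) l = (fourier A l) ^t*.
Proof.
apply: (fourierK (F := fun l => (fourier A l) ^t*)) => i j ij.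
by rewrite (fourier_sym _ ij) map_trmx.
Qed.

Lemma fourier_tinv {R : realType} {n p} (A : tensor R n n p) l :
  fourier (tinv A) l = invmx (fourier A l).
Proof.
apply: (fourierK (F := fun l => invmx (fourier A l))) => i j ij.
by rewrite (fourier_sym _ ij) map_invmx.
Qed.

Lemma adjmxM {R : realType} {m n q} (A : 'M[R[i]]_(m, n))
    (B : 'M[R[i]]_(n, q)) : (A *m B) ^t* = B ^t* *m A ^t*.
Proof. by rewrite trmx_mul map_mxM. Qed.

Lemma is_mpinv_unique {R : realType} {m n} (A : 'M[R[i]]_(m, n)) X Y :
  is_mpinv A X -> is_mpinv A Y -> X = Y.
Proof.
move=> [X1 X2 X3 X4] [Y1 Y2 Y3 Y4].
have AXY : A *m X = A *m Y.
  by rewrite -[LHS]X3 -[in LHS]Y1 -mulmxA adjmxM X3 Y3 mulmxA X1.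
have XYA : X *m A = Y *m A.
  by rewrite -[LHS]X4 -[in LHS]Y1 -mulmxA mulmxA adjmxM X4 Y4 -mulmxA
             [A *m (X *m A)]mulmxA X1.
by rewrite -X2 -mulmxA AXY mulmxA XYA Y2.
Qed.

Lemma gram_unit {R : realType} {m n} (B : 'M[R[i]]_(m, n)) :
  row_free B -> B *m B ^t* \in unitmx.
Proof.
move=> Bfree; rewrite -row_free_unit; apply/inj_row_free => u u0.
have : (u *m B) *m (u *m B) ^t* = 0.
  by rewrite adjmxM mulmxA -(mulmxA u) u0 mul0mx.
move=> /(congr1 (fun M : 'M[R[i]]_1 => M 0 0)); rewrite -dotmxE mxE.
move=> /eqP; rewrite dnorm_eq0 => /eqP uB0.
by apply: (row_free_inj Bfree); rewrite uB0 mul0mx.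
Qed.

Lemma is_mpinv_factor {R : realType} {m n k} (C : 'M[R[i]]_(m, k))
    (B : 'M[R[i]]_(k, n)) : row_free (C ^t*) -> row_free B ->
  exists X, is_mpinv (C *m B) X.
Proof.
move=> Cfree Bfree; set A := C *m B; have AE : A = C *m B by [].
pose G := B *m B ^t*; pose K := C ^t* *m C.
have Gu : G \in unitmx by exact: gram_unit.
have Ku : K \in unitmx.
  by rewrite /K -{2}[C]trmxCK; exact: gram_unit.
have herm j (M : 'M[R[i]]_j) : M ^t* = M -> (invmx M) ^t* = invmx M.
  by move=> M1; rewrite trmx_inv map_invmx M1.
have Gh : (invmx G) ^t* = invmx G by apply: herm; rewrite adjmxM trmxCK.
have Kh : (invmx K) ^t* = invmx K by apply: herm; rewrite adjmxM trmxCK.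
pose X := B ^t* *m invmx G *m (invmx K *m C ^t*).
have AX : A *m X = C *m invmx K *m C ^t*.
  rewrite AE /X -!mulmxA; congr (C *m _).
  by rewrite !mulmxA -/G mulmxV // mul1mx.
have XA : X *m A = B ^t* *m invmx G *m B.
  rewrite AE /X -!mulmxA; congr (_ *m (_ *m _)).
  by rewrite (mulmxA (C ^t*)) -/K mulmxA mulVmx // mul1mx.
exists X; split.
- by rewrite AX AE -!mulmxA (mulmxA (C ^t*)) -/K (mulmxA (invmx K)) mulVmx //
             mul1mx.
- rewrite XA /X -!mulmxA; congr (_ *m (_ *m _)).
  by rewrite !mulmxA -/G mulmxV // mul1mx.
- by rewrite AX !adjmxM trmxCK Kh mulmxA.
- by rewrite XA !adjmxM trmxCK Gh mulmxA.
Qed.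

Lemma is_mpinv_exists {R : realType} {m n} (A : 'M[R[i]]_(m, n)) :
  exists X, is_mpinv A X.
Proof.
rewrite -(mulmx_base A); apply: is_mpinv_factor; last exact: row_base_free.
by rewrite /row_free mxrank_map mxrank_tr; exact: col_base_full.
Qed.

Lemma mpinvP {R : realType} {m n} (A : 'M[R[i]]_(m, n)) :
  is_mpinv A (mpinv A).
Proof.
rewrite /mpinv; case: xgetP => [X _ //|noX].
by have [X /noX] := is_mpinv_exists A.
Qed.

Lemma mpinv_conj {R : realType} {m n} (A : 'M[R[i]]_(m, n)) :
  mpinv (map_mx Num.conj A) = map_mx Num.conj (mpinv A).
Proof.
apply: (is_mpinv_unique (mpinvP _)); have [A1 A2 A3 A4] := mpinvP A.
split; rewrite -!map_mxM ?A1 ?A2 //.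
- by rewrite -[in RHS]A3 map_trmx.
- by rewrite -[in RHS]A4 map_trmx.
Qed.

Lemma fourier_tpinv {R : realType} {m n p} (A : tensor R m n p) l :
  fourier (tpinv A) l = mpinv (fourier A l).
Proof.
apply: (fourierK (F := fun l => mpinv (fourier A l))) => i j ij.
by rewrite (fourier_sym _ ij) mpinv_conj.
Qed.

(* Without the hypothesis every selection probability is 0 / 0 = 0; rank growth
   rules out a zero residual before step r on histories of positive
   probability. *)
Lemma sum_sel_prob {R : realType} {n r p} (W : tensor R n r p) :
  tfro2 W != 0 -> \sum_j sel_prob W j = 1.
Proof.
move=> W0; rewrite -mulr_suml -[RHS](divff W0); congr (_ / _).
rewrite exchange_big /=; apply: eq_bigr => k _; apply: eq_bigr => j _.
by rewrite big_ord1; apply: eq_bigr => c _; rewrite ffunE mxE.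
Qed.

(* Main.v *)
(** Parseval turns the squared Frobenius norm into an average over frequencies.
At one frequency let W = V P be the current residual of T-ARP, where P is the
orthogonal projector onto the complement of the selected rows of V.  Start from
B = X - X V V^H and, when j is selected, with w = W(j,:) and a = |w|^2,
subtract from B the rank-one term (B e_j) (w W^H) / a.  Then B W = 0 and the
columns of B with selected indices vanish, so that after r steps
B = X - X(:,J) V(J,:)^{-H} V^H.  Since B W = 0, a step increases |B|^2 by exactly
|B e_j|^2 / a.  As q_j <= eta a / |W|^2 and |W|^2 = tr P = r - k, the expected
increase is at most eta |B|^2 / (r - k).  Rank growth ensures a > 0 at every
frequency for each index selected with positive probability. *)

Require Import Defs.
From mathcomp Require Import all_boot all_order all_algebra.
From mathcomp Require Import reals.
From mathcomp.real_closed Require Import complex.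
From mathcomp Require Import ring.

Set Implicit Arguments.
Unset Strict Implicit.
Unset Printing Implicit Defensive.

Import Order.TTheory GRing.Theory Num.Theory.
Local Open Scope ring_scope.
Local Open Scope complex_scope.
Local Open Scope sesquilinear_scope.

(** * The Frobenius norm of complex matrices and the pseudoinverse of a row *)

Definition fro2 {R : realType} {m n} (A : 'M[R[i]]_(m, n)) : R :=
  \sum_i \sum_j (complex.Re (A i j) ^+ 2 + complex.Im (A i j) ^+ 2).

Lemma fro2E {R : realType} {m n} (A : 'M[R[i]]_(m, n)) :
  (fro2 A)%:C = \tr (A *m A ^t*).
Proof.
rewrite rmorph_sum; apply: eq_bigr => i _; rewrite mxE rmorph_sum.
apply: eq_bigr => j _; rewrite !mxE conjE; apply/eqP; rewrite eq_complex /=.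
by case: (A i j) => x y /=; apply/andP; split; apply/eqP; ring.
Qed.

Lemma complexRI {R : realType} (x y : R) : x%:C = y%:C -> x = y.
Proof. by case. Qed.

Lemma fro2_ge0 {R : realType} {m n} (A : 'M[R[i]]_(m, n)) : 0 <= fro2 A.
Proof. by do 2!apply: sumr_ge0 => ? _; rewrite addr_ge0 ?sqr_ge0. Qed.

Lemma fro2_eq0 {R : realType} {m n} (A : 'M[R[i]]_(m, n)) :
  fro2 A = 0 -> A = 0.
Proof.
move=> /eqP; rewrite psumr_eq0 => [/allP A0|i _]; last first.
  by apply: sumr_ge0 => ? _; rewrite addr_ge0 ?sqr_ge0.
apply/matrixP => i j; rewrite mxE.
have := A0 i (mem_index_enum i); rewrite psumr_eq0 => [/allP Ai0|j' _].
  have := Ai0 j (mem_index_enum j).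
  rewrite paddr_eq0 ?sqr_ge0 // !sqrf_eq0 /= => /andP[re0 im0].
  by apply/eqP; rewrite eq_complex /= re0.
by rewrite addr_ge0 ?sqr_ge0.
Qed.

(** The hypothesis removes both cross terms of the trace, the second being the adjoint of the
    first. *)
Lemma fro2_pythag {R : realType} {m n} (A B : 'M[R[i]]_(m, n)) :
  A *m B ^t* = 0 -> fro2 (A - B) = fro2 A + fro2 B.
Proof.
move=> AB0; have BA0 : B *m A ^t* = 0.
  by rewrite -[B]trmxCK -adjmxM AB0 trmx0 map_mx0.
apply: complexRI; rewrite rmorphD /= !fro2E -mxtraceD.
by rewrite linearB /= map_mxB mulmxBl !mulmxBr AB0 BA0 subr0 sub0r opprK.
Qed.

Lemma fro2_scale {R : realType} {m n} (a : R) (A : 'M[R[i]]_(m, n)) :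
  fro2 (a%:C *: A) = a ^+ 2 * fro2 A.
Proof.
rewrite /fro2 mulr_sumr; apply: eq_bigr => i _.
rewrite mulr_sumr; apply: eq_bigr => j _; rewrite mxE.
by case: (A i j) => x y /=; ring.
Qed.

Lemma adj_scale {R : realType} {m n} (a : R) (A : 'M[R[i]]_(m, n)) :
  (a%:C *: A) ^t* = a%:C *: A ^t*.
Proof.
apply/matrixP => i j; rewrite !mxE rmorphM; congr (_ * _).
by apply: etrans (conjE _) _; rewrite /= oppr0.
Qed.

Lemma row_mul_adj {R : realType} {n} (w : 'rV[R[i]]_n) :
  w *m w ^t* = (fro2 w)%:C%:M.
Proof. by rewrite [LHS]mx11_scalar fro2E -trace_mx11. Qed.

Lemma fro2_outer {R : realType} {m n} (c : 'cV[R[i]]_m) (w : 'rV[R[i]]_n) :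
  fro2 (c *m w) = fro2 c * fro2 w.
Proof.
apply: complexRI; rewrite rmorphM /= fro2E adjmxM mulmxA -(mulmxA c).
by rewrite row_mul_adj mul_mx_scalar -scalemxAl mxtraceZ -fro2E mulrC.
Qed.

Lemma fro2_rows {R : realType} {m n} (A : 'M[R[i]]_(m, n)) :
  \sum_i fro2 (row i A) = fro2 A.
Proof.
apply: eq_bigr => i _; rewrite /fro2 big_ord1.
by apply: eq_bigr => j _; rewrite mxE.
Qed.

Lemma fro2_cols {R : realType} {m n} (A : 'M[R[i]]_(m, n)) :
  \sum_j fro2 (col j A) = fro2 A.
Proof.
rewrite [RHS]exchange_big; apply: eq_bigr => i _; apply: eq_bigr => j _.
by rewrite big_ord1 mxE.
Qed.

(** The Penrose equations have only one solution, so it suffices to check them for the explicit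
    candidate. *)
Lemma mpinv_row {R : realType} {n} (w : 'rV[R[i]]_n) : 0 < fro2 w ->
  mpinv w = (fro2 w)^-1%:C *: w ^t*.
Proof.
move=> w0; apply: is_mpinv_unique (mpinvP w) _.
have wK : w *m ((fro2 w)^-1%:C *: w ^t*) = 1%:M.
  by rewrite -scalemxAr row_mul_adj scale_scalar_mx -rmorphM /= mulVf ?gt_eqF.
split; rewrite ?wK ?mul1mx //.
- by rewrite -mulmxA wK mulmx1.
- by rewrite trmx1 map_mx1.
- by rewrite -scalemxAl adj_scale adjmxM trmxCK.
Qed.

(** * Fourier slices of the tensor operations and Parseval's identity *)

Lemma fourierB {R : realType} {m n p} (A B : tensor R m n p) l :
  fourier (A - B) l = fourier A l - fourier B l.
Proof.
rewrite /fourier -sumrB; apply: eq_bigr => k _.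
by rewrite -scalerBr -map_mxB !ffunE.
Qed.

Lemma fourier_tid {R : realType} n p (l : 'I_p) :
  fourier (tid n p : tensor R n n p) l = 1%:M.
Proof.
have p0 : (0 < p)%N by apply: leq_ltn_trans (ltn_ord l).
rewrite /fourier (bigD1 (Ordinal p0)) //= big1 => [|k k0].
  by rewrite /dft_angle ffunE /= muln0 mulr0 mul0r oppr0 expi0 scale1r map_mx1
             addr0.
by rewrite ffunE ifN ?map_mx0 ?scaler0.
Qed.

Lemma fourier_trow {R : realType} {m n p} (A : tensor R m n p) j l :
  fourier (trow j A) l = row j (fourier A l).
Proof.
rewrite /fourier linear_sum; apply: eq_bigr => k _.
by rewrite ffunE linearZ /= map_row.
Qed.

Lemma fourier_trows {R : realType} {m n p r} (J : r.-tuple 'I_m)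
    (A : tensor R m n p) l :
  fourier (trows J A) l = rowsub (tnth J) (fourier A l).
Proof.
apply/matrixP => i j; rewrite /fourier !mxE !summxE.
by apply: eq_bigr => k _; rewrite ffunE !mxE.
Qed.

Lemma fourier_tcols {R : realType} {m n p r} (J : r.-tuple 'I_n)
    (A : tensor R m n p) l :
  fourier (tcols J A) l = colsub (tnth J) (fourier A l).
Proof.
apply/matrixP => i j; rewrite /fourier !mxE !summxE.
by apply: eq_bigr => k _; rewrite ffunE !mxE.
Qed.

(** Expanding each squared modulus gives a double sum over frontal slices; summing over frequencies
    leaves only its diagonal, by [dft_orth]. *)
Lemma tfro2_parseval {R : realType} {m n p} (A : tensor R m n p) :
  tfro2 A = p%:R^-1 * \sum_l fro2 (fourier A l).
Proof.
have [p0|p0] := posnP p.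
  by subst p; rewrite /tfro2 !big_ord0 mulr0.
apply: (@mulfI _ p%:R); first by rewrite pnatr_eq0 -lt0n.
rewrite mulrA divff ?pnatr_eq0 -?lt0n // mul1r; apply: complexRI.
rewrite rmorphM rmorph_nat /tfro2 /fro2 exchange_big /= [in RHS]exchange_big /=.
rewrite !rmorph_sum mulr_sumr; apply: eq_bigr => i _.
rewrite exchange_big /= [in RHS]exchange_big /= !rmorph_sum mulr_sumr.
apply: eq_bigr => j _; rewrite !rmorph_sum /=.
under [RHS]eq_bigr => l _.
  have -> : (complex.Re (fourier A l i j) ^+ 2 +
             complex.Im (fourier A l i j) ^+ 2)%:C =
      \sum_k \sum_k' (A k i j)%:C * (A k' i j)%:C *
        (expi (dft_angle R p k' l) * expi (- dft_angle R p k l)).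
    transitivity (fourier A l i j * Num.conj (fourier A l i j)).
      rewrite conjE; case: (fourier A l i j) => x y; apply/eqP.
      by rewrite eq_complex /=; apply/andP; split; apply/eqP; ring.
    rewrite /fourier summxE rmorph_sum big_distrl; apply: eq_bigr => k _.
    rewrite big_distrr; apply: eq_bigr => k' _ /=.
    rewrite !mxE rmorphM /= -expiN opprK.
    have -> : Num.conj (A k' i j)%:C = (A k' i j)%:C.
      by apply: etrans (conjE _) _; rewrite /= oppr0.
    (* [dft_angle] is symmetric in its two indices; the swap puts the frequency where [dft_orth] has
       its summation index. *)
    by rewrite /dft_angle (mulnC l k) (mulnC l k'); ring.
  over.
rewrite exchange_big mulr_sumr; apply: eq_bigr => k _ /=.
rewrite exchange_big (bigD1 k) //= [X in _ + X]big1 => [|k' kk'];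
  rewrite -mulr_sumr dft_orth ?eqxx ?muln1 ?addr0.
  by rewrite rmorphXn /= mulrC expr2.
by rewrite eq_sym (negbTE kk') muln0 mulr0.
Qed.

(** * Selection probabilities and their recursion along histories *)

Lemma freq_energyE {R : realType} {n r p} (W : tensor R n r p) j l :
  freq_energy W j l = fro2 (row j (fourier W l)).
Proof.
by rewrite /fro2 big_ord1; apply: eq_bigr => c _; rewrite !mxE.
Qed.

(** Parseval puts the same factor [p%:R^-1] in the numerator and the denominator. *)
Lemma sel_prob_joint {R : realType} {n r p} (W : tensor R n r p) j :
  sel_prob W j = joint_prob W j.
Proof.
rewrite /sel_prob /joint_prob !tfro2_parseval.
have -> : \sum_l fro2 (fourier (trow j W) l) = \sum_l freq_energy W j l.
  by apply: eq_bigr => l _; rewrite fourier_trow freq_energyE.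
have -> : \sum_l fro2 (fourier W l) = \sum_i \sum_l freq_energy W i l.
  rewrite [RHS]exchange_big; apply: eq_bigr => l _ /=; rewrite -fro2_rows.
  by apply: eq_bigr => i _; rewrite freq_energyE.
have [p0|p0] := posnP p; first by subst p; rewrite !(big_ord0, mulr0, mul0r).
by rewrite -mulf_div divff ?mul1r // invr_neq0 // pnatr_eq0 -lt0n.
Qed.

Lemma tfro2_ge0 {R : realType} {m n p} (A : tensor R m n p) : 0 <= tfro2 A.
Proof. by do 3!apply: sumr_ge0 => ? _; rewrite sqr_ge0. Qed.

Lemma sel_prob_ge0 {R : realType} {n r p} (W : tensor R n r p) j :
  0 <= sel_prob W j.
Proof. by rewrite divr_ge0 ?tfro2_ge0. Qed.

(** A zero residual gives every index the default probability [0 / 0 = 0], hence an inequality,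
    which is what the expectation bound uses. *)
Lemma sum_sel_prob_le1 {R : realType} {n r p} (W : tensor R n r p) :
  \sum_j sel_prob W j <= 1.
Proof.
have [W0|/sum_sel_prob -> //] := eqVneq (tfro2 W) 0.
by rewrite big1 // => j _; rewrite /sel_prob W0 invr0 mulr0.
Qed.

(** [tarp_prob] recurses on the first selection, whereas the inductions below extend a history at
    its end. *)
Lemma tarp_prob_rcons {R : realType} {n r p} (V : tensor R n r p) s j :
  tarp_prob V (rcons s j) = tarp_prob V s * sel_prob (tarp_residual V s) j.
Proof.
elim: s V => [|i s IH] V /=; first by rewrite mulr1 mul1r.
by rewrite IH mulrA.
Qed.

Lemma tarp_residual_rcons {R : realType} {n r p} (V : tensor R n r p) s j :
  tarp_residual V (rcons s j) = tarp_step (tarp_residual V s) j.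
Proof. by rewrite /tarp_residual -cats1 foldl_cat. Qed.

Lemma tarp_prob_ge0 {R : realType} {n r p} (V : tensor R n r p) s :
  0 <= tarp_prob V s.
Proof.
by elim: s V => [|j s IH] V //=; rewrite mulr_ge0 ?sel_prob_ge0.
Qed.

Lemma sum_tuple_rcons {R : realType} (T : finType) k (f : seq T -> R) :
  \sum_(s : k.+1.-tuple T) f s =
  \sum_(s : k.-tuple T) \sum_j f (rcons s j).
Proof.
rewrite pair_bigA /=.
pose g (x : k.-tuple T * T) : k.+1.-tuple T := [tuple of rcons x.1 x.2].
rewrite (reindex g) //=; apply: onW_bij.
apply: inj_card_bij => [[s i] [t j] /(congr1 val) /= /rcons_inj [st ->]|].
  by congr pair; apply: val_inj.
by rewrite card_prod !card_tuple expnSr.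
Qed.

(** * One selection step at a single frequency *)

Definition err_step {R : realType} {m n r} (W : 'M[R[i]]_(n, r))
    (B : 'M[R[i]]_(m, n)) (j : 'I_n) : 'M[R[i]]_(m, n) :=
  B - (fro2 (row j W))^-1%:C *: (col j B *m (row j W *m W ^t*)).

Definition res_step {R : realType} {n r} (W : 'M[R[i]]_(n, r)) (j : 'I_n) :
    'M[R[i]]_(n, r) :=
  W - W *m ((fro2 (row j W))^-1%:C *: ((row j W) ^t* *m row j W)).

(** The last clause of [sel_proj] turns a vanishing residual row into a linear dependence among rows
    of [V]. [sel_orth] gives the exact growth of the error, [sel_row0] keeps earlier zero columns
    zero, and [sel_shape] with [sel_col0] determines [B] once the selected rows are invertible. *)
Record sel_inv {R : realType} {m n r} (X : 'M[R[i]]_(m, n))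
    (V : 'M[R[i]]_(n, r)) (s : seq 'I_n) (W : 'M[R[i]]_(n, r))
    (B : 'M[R[i]]_(m, n)) : Prop := SelInv {
  sel_proj : exists P : 'M[R[i]]_r,
    [/\ P ^t* = P, P *m P = P, W = V *m P, \tr P = r%:R - (size s)%:R &
        (1%:M - P <= \sum_(i <- s) <<row i V>>)%MS];
  sel_shape : exists C, B = X - C *m V ^t*;
  sel_orth : B *m W = 0;
  sel_row0 : forall i, i \in s -> row i W = 0;
  sel_col0 : forall i, i \in s -> col i B = 0 }.

Lemma sel_inv_nil {R : realType} {m n r} (X : 'M[R[i]]_(m, n))
    (V : 'M[R[i]]_(n, r)) : V ^t* *m V = 1%:M ->
  sel_inv X V [::] V (X - X *m V *m V ^t*).
Proof.
move=> VV; split=> //.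
- exists 1%:M; rewrite trmx1 map_mx1 !mulmx1 mxtrace1 subr0 subrr.
  by split=> //; rewrite sub0mx.
- by exists (X *m V).
- by rewrite mulmxBl -!mulmxA VV mulmx1 subrr.
Qed.

Section Step.
Variables (R : realType) (m n r : nat) (X : 'M[R[i]]_(m, n)).
Variables (V : 'M[R[i]]_(n, r)) (s : seq 'I_n) (W : 'M[R[i]]_(n, r)).
Variables (B : 'M[R[i]]_(m, n)) (j : 'I_n).
Hypothesis VV : V ^t* *m V = 1%:M.
Hypothesis inv : sel_inv X V s W B.

Lemma res_gram (P : 'M[R[i]]_r) : P ^t* = P -> P *m P = P -> W = V *m P ->
  W ^t* *m W = P.
Proof.
move=> Ph PP ->.
by rewrite adjmxM Ph -mulmxA (mulmxA (V ^t*)) VV mul1mx PP.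
Qed.

(** Since [W ^t* *m W = P], the energy is [\tr P]. It is the denominator of [freq_prob], hence the
    source of [r - k] in [Gamma]. *)
Lemma fro2_res : fro2 W = r%:R - (size s)%:R.
Proof.
have [P [Ph PP WE trP _]] := sel_proj inv.
apply: complexRI; rewrite fro2E mxtrace_mulC (res_gram Ph PP WE) trP.
by rewrite rmorphB !rmorph_nat.
Qed.

(** If [row j V *m P = 0], then [1%:M - P] fixes [row j V], and its row space lies in the selected
    span. *)
Lemma res_row_eq0 : row j W = 0 ->
  (row j V <= \sum_(i <- s) <<row i V>>)%MS.
Proof.
have [P [_ _ WE _ Ps]] := sel_proj inv.
rewrite WE row_mul => vP0.
have -> : row j V = row j V *m (1%:M - P).
  by rewrite mulmxBr mulmx1 vP0 subr0.
exact: mulmx_sub.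
Qed.

Hypothesis a0 : 0 < fro2 (row j W).

Lemma sel_inv_rcons : sel_inv X V (rcons s j) (res_step W j) (err_step W B j).
Proof.
have [P [Ph PP WE trP Ps]] := sel_proj inv.
have := a0; set w := row j W => w0; pose a := fro2 w.
have wP : w *m P = w by rewrite /w WE -row_mul -mulmxA PP.
(* [Q] is the orthogonal projector onto the line of [w]. As [P] fixes [w], the difference [P - Q] is
   the projector for the extended history. *)
pose Q := a^-1%:C *: (w ^t* *m w).
have ww : w *m w ^t* = a%:C%:M by exact: row_mul_adj.
have aV : a^-1%:C * a%:C = 1 by rewrite -rmorphM mulVf ?gt_eqF.
have wQ : w *m Q = w.
  by rewrite -scalemxAr mulmxA ww mul_scalar_mx scalerA aV scale1r.
have QP : Q *m P = Q by rewrite -scalemxAl -mulmxA wP.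
have Qh : Q ^t* = Q by rewrite adj_scale adjmxM trmxCK.
have PQ : P *m Q = Q by rewrite -[RHS]Qh -[in RHS]QP adjmxM Qh Ph.
have QQ : Q *m Q = Q by rewrite {1}/Q -scalemxAl -mulmxA wQ.
have rE : res_step W j = W - W *m Q by [].
have eE : err_step W B j = B - a^-1%:C *: (col j B *m (w *m W ^t*)) by [].
have row0 i : i \in rcons s j -> row i (res_step W j) = 0.
  rewrite mem_rcons in_cons rE linearB /= row_mul => /predU1P[->|si].
    by rewrite -/w wQ subrr.
  by rewrite (sel_row0 inv si) mul0mx subrr.
split=> //.
- exists (P - Q); split.
  + by rewrite linearB /= map_mxB Ph Qh.
  + by rewrite mulmxBr !mulmxBl PP QP PQ QQ subrr subr0.
  + by rewrite rE WE -mulmxA PQ mulmxBr.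
  + rewrite linearB /= trP mxtraceZ mxtrace_mulC ww mxtrace_scalar mulr1n aV.
    by rewrite size_rcons -natr1 opprD addrA.
  + rewrite opprB addrCA addrC big_rcons /= addmx_sub //.
      by apply: submx_trans Ps _; exact: addsmxSl.
    apply: scalemx_sub; apply: mulmx_sub.
    (* [w] differs from [row j V] by a vector in the row space of [1%:M - P], so it lies in the
       enlarged span. *)
    have -> : w = row j V - row j V *m (1%:M - P).
      by rewrite mulmxBr mulmx1 /w WE row_mul subKr.
    apply: addmx_sub; first by apply: submx_trans (addsmxSr _ _); rewrite genmxE.
    rewrite eqmx_opp; apply: submx_trans (addsmxSl _ _).
    exact: mulmx_sub.
- have [C BE] := sel_shape inv.
  (* Because [W ^t* = P *m V ^t*], the correction is again a left multiple of [V ^t*]. *)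
  exists (C + a^-1%:C *: (col j B *m (w *m P))).
  rewrite eE {1}BE mulmxDl opprD addrA; congr (_ - _).
  by rewrite WE adjmxM Ph -scalemxAl -!mulmxA.
(* Both [P] and [Q] fix [w], so [w *m (P - Q) = 0] and the correction annihilates the new
   residual. *)
- have WW' : W ^t* *m res_step W j = P - Q.
    by rewrite rE mulmxBr mulmxA (res_gram Ph PP WE) PQ.
  rewrite eE mulmxBl -scalemxAl -!mulmxA WW' (mulmxBr w) wP wQ subrr mulmx0 scaler0.
  by rewrite rE mulmxBr mulmxA (sel_orth inv) mul0mx !subr0.
- move=> i; rewrite mem_rcons in_cons => /predU1P si.
  (* The inner product of [w] with [row i W] is [a] for [i = j], which cancels the column; for
     earlier [i] it is zero and the column stays zero. *)
  have -> : col i (err_step W B j) =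
      col i B - a^-1%:C *: (col j B *m (w *m (row i W) ^t*)).
    by rewrite eE linearB linearZ /= tr_row map_col !colE !mulmxA.
  case: si => [->|si].
    by rewrite -/w ww mul_mx_scalar scalerA aV scale1r subrr.
  by rewrite (sel_row0 inv si) (sel_col0 inv si) trmx0 map_mx0 !mulmx0 scaler0 subrr.
Qed.

(** By [sel_orth] the correction is orthogonal to [B]. As [P] fixes [w], the row [w *m W ^t*] has
    the norm of [w], so one of the two factors [a^-1] in the squared correction cancels. *)
Lemma fro2_err_step :
  fro2 (err_step W B j) = fro2 B + fro2 (col j B) / fro2 (row j W).
Proof.
have [P [Ph PP WE _ _]] := sel_proj inv.
have := a0; set w := row j W => w0.
rewrite /err_step -/w fro2_pythag.
  rewrite fro2_scale fro2_outer.
  have -> : fro2 (w *m W ^t*) = fro2 w.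
    apply: complexRI; rewrite !fro2E adjmxM trmxCK mulmxA -(mulmxA w).
    by rewrite (res_gram Ph PP WE) /w WE -row_mul -mulmxA PP.
  by congr (_ + _); field; rewrite gt_eqF.
rewrite adj_scale -scalemxAr !adjmxM trmxCK -!mulmxA (mulmxA B).
by rewrite (sel_orth inv) mul0mx scaler0.
Qed.

End Step.

(** The vanishing of the selected columns of [X - C *m V ^t*] is a linear system that determines
    [C]. *)
Lemma sel_inv_full {R : realType} {m n r} (X : 'M[R[i]]_(m, n))
    (V : 'M[R[i]]_(n, r)) (s : r.-tuple 'I_n) W B :
  sel_inv X V s W B -> rowsub (tnth s) V \in unitmx ->
  B = X - colsub (tnth s) X *m invmx ((rowsub (tnth s) V) ^t*) *m V ^t*.
Proof.
case=> _ [C BE] _ _ col0 Vu; rewrite BE; congr (_ - _ *m _).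
have Vu' : (rowsub (tnth s) V) ^t* \in unitmx by rewrite map_unitmx unitmx_tr.
rewrite -[LHS](mulmxK Vu'); congr (_ *m _).
have : colsub (tnth s) B = 0.
  apply/matrixP => i c.
  have := congr1 (fun M : 'cV_m => M i 0) (col0 (tnth s c) (mem_tnth c s)).
  by rewrite !mxE.
have -> : colsub (tnth s) B =
    colsub (tnth s) X - C *m (rowsub (tnth s) V) ^t*.
  apply/matrixP => i c; rewrite BE !mxE; congr (_ - _).
  by apply: eq_bigr => k _; rewrite !mxE.
by move/subr0_eq->.
Qed.

(** * Rank growth and positive energy at each frequency *)

Lemma mxrank_sum_rows {R : realType} {n r} (V : 'M[R[i]]_(n, r))
    (s : seq 'I_n) : (\rank (\sum_(i <- s) <<row i V>>)%MS <= size s)%N.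
Proof.
elim: s => [|i s IH]; first by rewrite big_nil mxrank0.
rewrite big_cons; apply: leq_trans (mxrank_adds_leqif _ _) _.
rewrite -[size _]add1n; apply: leq_add => //; by rewrite mxrank_gen rank_leq_row.
Qed.

Lemma sel_mx_adjE {R : realType} {n r k} (s : k.-tuple 'I_n)
    (V : 'M[R[i]]_(n, r)) : (sel_mx s) ^t* *m V = rowsub (tnth s) V.
Proof.
apply/matrixP => c j; rewrite !mxE (bigD1 (tnth s c)) //= big1 => [|i si].
  by rewrite !mxE eqxx rmorph1 mul1r addr0.
by rewrite !mxE (negbTE si) rmorph0 mul0r.
Qed.

(** With zero energy, all rows selected by [rcons s j] would lie in a span of rank at most [size s],
    contradicting the rank hypothesis. *)
Lemma row_energy_gt0 {R : realType} {m n r} (X : 'M[R[i]]_(m, n))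
    (V : 'M[R[i]]_(n, r)) s W B j :
  sel_inv X V s W B ->
  \rank ((sel_mx (in_tuple (rcons s j))) ^t* *m V) = size (rcons s j) ->
  0 < fro2 (row j W).
Proof.
move=> inv; rewrite sel_mx_adjE => rk.
rewrite lt_def fro2_ge0 andbT; apply/eqP => /fro2_eq0 w0.
have := mxrank_sum_rows V s; rewrite leqNgt => /negP; apply.
rewrite -(size_rcons s j) -rk.
apply: mxrankS; apply/row_subP => c; rewrite row_rowsub.
have : tnth (in_tuple (rcons s j)) c \in rcons s j by exact: mem_tnth.
rewrite mem_rcons in_cons => /predU1P[->|]; first exact: res_row_eq0 inv w0.
move: (tnth _ _) => i; elim: s {inv rk c w0} => [|i' s IH] //.
rewrite in_cons big_cons => /predU1P[->|/IH is_].
  by apply: submx_trans (addsmxSl _ _); rewrite genmxE.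
exact: submx_trans is_ (addsmxSr _ _).
Qed.

(* Started at [B = X - X V V^H], this is the error of column selection at the
   frequency [l] once r indices are selected: see [err_full]. *)
Fixpoint err {R : realType} {m n r p} (l : 'I_p) (W : tensor R n r p)
    (B : 'M[R[i]]_(m, n)) (s : seq 'I_n) : 'M[R[i]]_(m, n) :=
  if s is j :: s' then err l (tarp_step W j) (err_step (fourier W l) B j) s'
  else B.

Lemma err_rcons {R : realType} {m n r p} (l : 'I_p) (W : tensor R n r p)
    (B : 'M[R[i]]_(m, n)) s j :
  err l W B (rcons s j) =
  err_step (fourier (tarp_residual W s) l) (err l W B s) j.
Proof. by elim: s W B => [|i s IH] W B //=; rewrite IH. Qed.

Lemma fourier_tarp_step {R : realType} {n r p} (W : tensor R n r p) j l :
  0 < fro2 (row j (fourier W l)) ->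
  fourier (tarp_step W j) l = res_step (fourier W l) j.
Proof.
move=> w0; rewrite fourier_tmul fourierB fourier_tid fourier_tmul fourier_tpinv.
by rewrite fourier_trow mpinv_row // mulmxBr mulmx1 -scalemxAl.
Qed.

Lemma tarp_prob_rcons_gt0 {R : realType} {n r p} (V : tensor R n r p) s j :
  0 < tarp_prob V (rcons s j) ->
  0 < tarp_prob V s /\ 0 < sel_prob (tarp_residual V s) j.
Proof.
rewrite tarp_prob_rcons !lt_def mulf_eq0 negb_or.
by rewrite tarp_prob_ge0 sel_prob_ge0 => /andP[/andP[-> ->]].
Qed.

(** * Expected growth of the error over the whole selection *)

Section Expectation.
Variables (R : realType) (m n r p : nat) (X : tensor R m n p).
Variables (V : tensor R n r p) (eta : 'I_r -> R).
Hypothesis orthoV : tmul (ttr V) V = tid r p.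
Hypothesis alignV : frequency_alignment V eta.
Hypothesis rankV : rank_growth V.
Hypothesis eta_ge0 : forall k, 0 <= eta k.

Let B0 l := fourier X l - fourier X l *m fourier V l *m (fourier V l) ^t*.
Let B l s := err l V (B0 l) s.

Lemma fourier_ortho l : (fourier V l) ^t* *m fourier V l = 1%:M.
Proof. by rewrite -fourier_ttr -fourier_tmul orthoV fourier_tid. Qed.

Lemma rank_growth_seq s : (size s <= r)%N -> 0 < tarp_prob V s ->
  forall l : 'I_p, \rank ((sel_mx (in_tuple s)) ^t* *m fourier V l) = size s.
Proof. exact: (rankV (s := in_tuple s)). Qed.

(** Positive probability only makes the energy summed over frequencies positive; rank growth
    supplies the positivity at [l] that [sel_inv_rcons] requires. *)
Lemma tarp_sel_inv l s : (size s <= r)%N -> 0 < tarp_prob V s ->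
  sel_inv (fourier X l) (fourier V l) s (fourier (tarp_residual V s) l) (B l s).
Proof.
elim/last_ind: s => [_ _|s j IH sr sj0].
  exact: sel_inv_nil (fourier_ortho l).
have [s0 _] := tarp_prob_rcons_gt0 sj0.
have inv : sel_inv (fourier X l) (fourier V l) s
    (fourier (tarp_residual V s) l) (B l s).
  by apply: IH s0; apply: ltnW; rewrite size_rcons in sr.
have w0 := row_energy_gt0 inv (rank_growth_seq sr sj0 l).
rewrite tarp_residual_rcons /B err_rcons fourier_tarp_step //.
exact: sel_inv_rcons (fourier_ortho l) inv w0.
Qed.

(** The increase [fro2 (col j (B l s)) / a] is weighted by at most [eta k * a / (r - k)]. The energy
    [a] cancels, and summing over [j] restores [fro2 (B l s)]. *)
Lemma expected_err_step (k : 'I_r) (s : k.-tuple 'I_n) l :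
  0 < tarp_prob V s ->
  \sum_j sel_prob (tarp_residual V s) j * fro2 (B l (rcons s j)) <=
  (1 + eta k / (r - k)%:R) * fro2 (B l s).
Proof.
move=> s0; set W := tarp_residual V s.
have sr : (size s <= r)%N by rewrite size_tuple ltnW.
have inv := tarp_sel_inv l sr s0.
have rk : (r - k)%:R = fro2 (fourier W l) :> R.
  by rewrite (fro2_res (fourier_ortho l) inv) size_tuple natrB // ltnW.
have rk0 : (0 : R) < (r - k)%:R by rewrite ltr0n subn_gt0.
pose b := fro2 (B l s).
apply: (@le_trans _ _ (\sum_j (sel_prob W j * b +
    eta k / (r - k)%:R * fro2 (col j (B l s))))).
  apply: ler_sum => j _.
  (* An index of probability zero contributes nothing on the left; rank growth gives positive energy
     only for the others. *)
  have [w0|] := ltP 0 (sel_prob W j); last first.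
    move=> w0; have -> : sel_prob W j = 0.
      by apply/eqP; rewrite eq_le w0 sel_prob_ge0.
    rewrite !mul0r add0r mulr_ge0 ?fro2_ge0 //.
    by rewrite divr_ge0 ?eta_ge0 ?ltW.
  have sj0 : 0 < tarp_prob V (rcons s j) by rewrite tarp_prob_rcons mulr_gt0.
  have sjr : (size (rcons s j) <= r)%N by rewrite size_rcons size_tuple.
  have a0 := row_energy_gt0 inv (rank_growth_seq sjr sj0 l).
  rewrite /B err_rcons (fro2_err_step (fourier_ortho l) inv a0) mulrDr lerD2l.
  rewrite -/W in a0 *; set a := fro2 (row j _) in a0 *.
  have sel : sel_prob W j <= eta k * (a / (r - k)%:R).
    rewrite sel_prob_joint; have := alignV s0 (l := l) (j := j).
    rewrite -/W freq_energyE => /(_ a0); rewrite /freq_prob freq_energyE.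
    congr (_ <= _ * (_ / _)); rewrite rk -fro2_rows.
    by apply: eq_bigr => i _; rewrite freq_energyE.
  rewrite mulrCA [leRHS]mulrC ler_wpM2l ?fro2_ge0 //.
  by rewrite ler_pdivrMr // mulrAC -mulrA.
rewrite big_split /= -mulr_suml -mulr_sumr fro2_cols mulrDl mul1r lerD2r.
by rewrite ler_piMl ?fro2_ge0 ?sum_sel_prob_le1.
Qed.

(** Summed rather than averaged over frequencies; the Parseval factor [p%:R^-1] returns in
    [tarp_expect_err_le]. *)
Let loss k := \sum_(s : k.-tuple 'I_n)
  tarp_prob V s * \sum_(l < p) fro2 (B l s).

(** Conditioning on the first [k] selections and exchanging sums reduces this to [expected_err_step]
    at each frequency. *)
Lemma loss_step (k : 'I_r) :
  loss k.+1 <= (1 + eta k / (r - k)%:R) * loss k.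
Proof.
rewrite /loss (sum_tuple_rcons _
  (fun s => tarp_prob V s * \sum_(l < p) fro2 (B l s))) mulr_sumr.
apply: ler_sum => s _.
under eq_bigr do rewrite tarp_prob_rcons -mulrA.
rewrite -mulr_sumr mulrCA.
have [s0|s0] := ltP 0 (tarp_prob V s); last first.
  have -> : tarp_prob V s = 0 by apply/eqP; rewrite eq_le s0 tarp_prob_ge0.
  by rewrite !mul0r.
rewrite (ler_wpM2l (ltW s0)) // mulr_sumr.
under eq_bigr do rewrite mulr_sumr.
by rewrite exchange_big; apply: ler_sum => l _; exact: expected_err_step.
Qed.

(** The product is a filtered one over ['I_r] because [eta] is indexed by ['I_r]. *)
Lemma loss_le k : (k <= r)%N ->
  loss k <= (\prod_(i < r | (i < k)%N) (1 + eta i / (r - i)%:R)) * loss 0.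
Proof.
elim: k => [_|k IH kr]; first by rewrite big_pred0 ?mul1r.
apply: le_trans (loss_step (Ordinal kr)) _.
rewrite (bigD1 (Ordinal kr)) //= -mulrA ler_wpM2l //.
  by rewrite addr_ge0 ?divr_ge0 ?eta_ge0.
apply: le_trans (IH (ltnW kr)) _; rewrite le_eqVlt; apply/orP; left.
apply/eqP; congr (_ * _); apply: eq_bigl => i.
by rewrite ltnS -(inj_eq val_inj) /= andbC -ltn_neqAle.
Qed.

Lemma loss0 : loss 0 = \sum_(l < p) fro2 (B0 l).
Proof.
rewrite /loss (big_pred1 [tuple]) /= ?mul1r // => s.
by apply/esym/eqP; exact: tuple0.
Qed.

Lemma expected_loss_le : loss r <= Gamma eta * \sum_(l < p) fro2 (B0 l).
Proof.
rewrite -loss0; apply: le_trans (loss_le (leqnn r)) _.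
by rewrite /Gamma (eq_bigl xpredT) // => i; rewrite ltn_ord.
Qed.

Lemma err_full l (J : r.-tuple 'I_n) : 0 < tarp_prob V J ->
  fourier (X - tmul (tmul (tcols J X) (tinv (ttr (trows J V)))) (ttr V)) l =
  B l J.
Proof.
move=> J0; have Jr : (size J <= r)%N by rewrite size_tuple.
rewrite (sel_inv_full (tarp_sel_inv l Jr J0)); last first.
  by rewrite -row_free_unit /row_free -sel_mx_adjE (rankV _ J0) ?eqxx.
rewrite fourierB !fourier_tmul fourier_tinv !fourier_ttr.
by rewrite fourier_tcols fourier_trows.
Qed.

Lemma tarp_expect_err_le :
  tarp_expect V (fun J =>
      tfro2 (X - tmul (tmul (tcols J X) (tinv (ttr (trows J V)))) (ttr V)))
    <= Gamma eta * tfro2 (X - tmul (tmul X V) (ttr V)).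
Proof.
rewrite [X in _ * X]tfro2_parseval.
have -> : \sum_l fro2 (fourier (X - tmul (tmul X V) (ttr V)) l) =
    \sum_(l < p) fro2 (B0 l).
  by apply: eq_bigr => l _; rewrite fourierB !fourier_tmul fourier_ttr.
rewrite mulrCA; have -> : tarp_expect V (fun J =>
      tfro2 (X - tmul (tmul (tcols J X) (tinv (ttr (trows J V)))) (ttr V))) =
    p%:R^-1 * loss r.
  rewrite /loss mulr_sumr; apply: eq_bigr => J _; rewrite tfro2_parseval mulrCA.
  congr (_ * _); have [J0|J0] := ltP 0 (tarp_prob V J).
    by congr (_ * _); apply: eq_bigr => l _; rewrite err_full.
  (* For a tuple of probability zero the selected rows of [V] may be singular, but its weight
     removes the term. *)
  have -> : tarp_prob V J = 0 by apply/eqP; rewrite eq_le J0 tarp_prob_ge0.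
  by rewrite !mul0r.
by rewrite ler_wpM2l ?invr_ge0 ?ler0n ?expected_loss_le.
Qed.

End Expectation.

(** * The constant under perfect alignment, and the theorem *)

Lemma Gamma1 {R : realType} r : Gamma (fun _ : 'I_r => 1 : R) = r.+1%:R.
Proof.
elim: r => [|r IH]; first by rewrite /Gamma big_ord0.
(* The product telescopes: dropping its first factor leaves the product for [r], since
   [r.+1 - k.+1 = r - k]. *)
rewrite /Gamma big_ord_recl subn0.
rewrite -[X in _ * X]/(Gamma (fun _ : 'I_r => 1)) IH mulrDl mul1r.
by rewrite div1r mulVf ?pnatr_eq0 // natr1.
Qed.

Theorem theorem4p9 (R : realType) (m n r p : nat)
    (X : tensor R m n p) (V : tensor R n r p) (eta : 'I_r -> R)
    (orthoV : tmul (ttr V) V = tid r p)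
    (eta_ge1 : forall k, 1 <= eta k)
    (alignV : aligned_rank_growth V eta) :
  tarp_expect V (fun J =>
      tfro2 (X - tmul (tmul (tcols J X) (tinv (ttr (trows J V)))) (ttr V)))
    <= Gamma eta * tfro2 (X - tmul (tmul X V) (ttr V))
  /\ (perfectly_aligned V ->
        aligned_rank_growth V (fun=> 1) /\
        Gamma (fun _ : 'I_r => 1 : R) = r.+1%:R).
Proof.
have [al rk] := alignV; split.
  apply: tarp_expect_err_le => // k.
  exact: le_trans ler01 (eta_ge1 k).
move=> perf; split; last exact: Gamma1.
by split=> // k s s0 l j _; rewrite mul1r (perf _ _ s0 l j).
Qed.
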